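(* For any pathograph $\mathfrak{H}$ with no rungs and urpaths $u_1,\dots,u_K$, and any finite set $\mathcal{F}$ of pathographs, there is a deterministic finite automaton $M$ over the alphabet $\Sigma_2=\{1,\dots,K\}\times 2^{V(\mathfrak{H})}$ that accepts a string $\sigma\in\Sigma_2^*$ if and only if $\sigma$ is the determination string of an $\mathcal{F}$-free realization of $\mathfrak{H}$.
   Context: All graphs are finite and simple. A pathograph is a tuple $\mathfrak{G}=(V,U,E,S,R,\pi)$ where $V$ (vertices) and $U$ (urpaths) are finite disjoint sets, $E\subseteq\binom{V}{2}$ (edges), $S\subseteq V\times U$ (spokes), $R\subseteq\binom{U}{2}$ (rungs), and $\pi:U\to\binom{V}{2}$ assigns to each urpath its two distinct endpoints, with $\pi(U)\cap E=\emptyset$. A realization of $\mathfrak{G}$ is a graph obtained as follows: start from the graph $(V,E)$; for each urpath $u$ with endpoints $a,b$ add new vertices $x_u^{(1)},\dots,x_u^{(m_u)}$ ($m_u\ge1$, the internal vertices of $u$) and the edges of the path $a x_u^{(1)}\cdots x_u^{(m_u)} b$; the only further edges added are: for each spoke $(v,u)$, a nonempty set of edges between $v$ and internal vertices of $u$; for each rung $\{u,u'\}$, a nonempty set of edges between internal vertices of $u$ and of $u'$. A graph $G$ contains a pathograph $\mathfrak{F}$ if some induced subgraph of $G$ is isomorphic to a realization of $\mathfrak{F}$; $G$ is $\mathcal{F}$-free if it contains no member of $\mathcal{F}$. Fix for each urpath $u_i$ of $\mathfrak{H}$ a left endpoint $a_i$ and right endpoint $b_i$. For a realization $G$ of $\mathfrak{H}$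 (with vertices of $\mathfrak{H}$ identified with their copies in $G$) in which $u_i$ is replaced by the path $P_i=a_i v_i^{(1)}\cdots v_i^{(k_i)} b_i$, the determination string of $G$ is the concatenation over $i=1,\dots,K$ (in order) of the strings $(i,N(v_i^{(1)})\cap V(\mathfrak{H}))(i,N(v_i^{(2)})\cap V(\mathfrak{H}))\cdots(i,N(v_i^{(k_i)})\cap V(\mathfrak{H}))$, where $N(x)$ is the neighbourhood of $x$ in $G$. *)

(* Defs.v *)
From Stdlib Require List.
From mathcomp Require Import all_boot.
Set Implicit Arguments.
Unset Strict Implicit.
Unset Printing Implicit Defensive.

(* A pathograph with vertices 'I_nv and urpaths 'I_nu.  The endpoint map
   pi(u) = {pg_a u, pg_b u}; pg_a u is the chosen left endpoint and pg_b u
   the chosen right endpoint of urpath u. *)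
Record pathograph := Pathograph {
  pg_nv : nat;
  pg_nu : nat;
  pg_E : rel 'I_pg_nv;
  pg_S : 'I_pg_nv -> 'I_pg_nu -> bool;
  pg_R : rel 'I_pg_nu;
  pg_a : 'I_pg_nu -> 'I_pg_nv;
  pg_b : 'I_pg_nu -> 'I_pg_nv
}.
Arguments pg_E : clear implicits.
Arguments pg_S : clear implicits.
Arguments pg_R : clear implicits.
Arguments pg_a : clear implicits.
Arguments pg_b : clear implicits.

(* Well-formedness: E, R are sets of unordered pairs (symmetric irreflexive
   relations), endpoints distinct, and pi(U) disjoint from E. *)
Definition pg_wf (H : pathograph) : Prop :=
  [/\ symmetric (pg_E H), irreflexive (pg_E H),
      symmetric (pg_R H), irreflexive (pg_R H) &
      (forall u, (pg_a H u != pg_b H u) && ~~ pg_E H (pg_a H u) (pg_b H u))].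

(* Vertices of a realization of H with m u internal vertices on urpath u:
   inl v = vertex v of H; inr (Tagged u i) = internal vertex x_u^(i+1). *)
Definition rvert (H : pathograph) (m : 'I_(pg_nu H) -> nat) : finType :=
  ('I_(pg_nv H) + {u : 'I_(pg_nu H) & 'I_(m u)})%type.
Arguments rvert : clear implicits.

Definition ivert (H : pathograph) (m : 'I_(pg_nu H) -> nat)
  (u : 'I_(pg_nu H)) (i : 'I_(m u)) : rvert H m :=
  inr (Tagged (fun u => 'I_(m u)) i).

(* Structural (forced) edges: edges of H and the path edges
   a x^(1) ... x^(m) b of each urpath. *)
Definition rstruct (H : pathograph) (m : 'I_(pg_nu H) -> nat)
  (x y : rvert H m) : bool :=
  match x, y with
  | inl v, inl w => pg_E H v w
  | inl v, inr p =>
      ((v == pg_a H (tag p)) && (nat_of_ord (tagged p) == 0))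
      || ((v == pg_b H (tag p)) && ((tagged p).+1 == m (tag p)))
  | inr p, inr q => (tag p == tag q) && ((tagged p).+1 == tagged q)
  | inr _, inl _ => false
  end.

(* Pairs on which additional edges may be placed: between v and internal
   vertices of u for a spoke (v,u); between internal vertices of u and u'
   for a rung {u,u'}. *)
Definition rallowed (H : pathograph) (m : 'I_(pg_nu H) -> nat)
  (x y : rvert H m) : bool :=
  match x, y with
  | inl v, inr p => pg_S H v (tag p)
  | inr p, inr q => pg_R H (tag p) (tag q)
  | _, _ => false
  end.

Definition radj (H : pathograph) (m : 'I_(pg_nu H) -> nat)
  (X : rel (rvert H m)) (x y : rvert H m) : bool :=
  [|| rstruct x y, rstruct y x, X x y | X y x].

Definition is_realization (H : pathograph) (m : 'I_(pg_nu H) -> nat)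
  (X : rel (rvert H m)) : Prop :=
  [/\ (forall u, 0 < m u),
      (forall x y, X x y -> rallowed x y),
      (forall v u, pg_S H v u ->
         exists i : 'I_(m u), X (inl v) (ivert i)) &
      (forall u u', pg_R H u u' ->
         exists (i : 'I_(m u)) (j : 'I_(m u')),
           X (ivert i) (ivert j) || X (ivert j) (ivert i))].

(* A graph (T, e) contains F if some induced subgraph of it is isomorphic to
   a realization of F, i.e. there is an induced embedding of a realization. *)
Definition contains_pg (T : finType) (e : rel T) (F : pathograph) : Prop :=
  exists (m : 'I_(pg_nu F) -> nat) (X : rel (rvert F m)) (f : rvert F m -> T),
    [/\ is_realization X, injective f &
        forall x y, e (f x) (f y) = radj X x y].

Definition pg_free (T : finType) (e : rel T) (Fs : seq pathograph) : Prop :=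
  forall F, List.In F Fs -> ~ contains_pg e F.

Definition det_string (H : pathograph) (m : 'I_(pg_nu H) -> nat)
  (X : rel (rvert H m)) : seq ('I_(pg_nu H) * {set 'I_(pg_nv H)}) :=
  flatten [seq [seq (u, [set v | radj X (ivert i) (inl v)]) | i <- enum 'I_(m u)]
          | u <- enum 'I_(pg_nu H)].

Record dfa (A : finType) := DFA {
  dfa_state : finType;
  dfa_start : dfa_state;
  dfa_final : pred dfa_state;
  dfa_trans : dfa_state -> A -> dfa_state
}.

Definition dfa_accepts (A : finType) (M : dfa A) (w : seq A) : bool :=
  @dfa_final A M (foldl (@dfa_trans A M) (@dfa_start A M) w).

(* Main.v *)
Require Import Defs.
From Stdlib Require List.
From mathcomp Require Import all_boot zify.
Set Implicit Arguments.
Unset Strict Implicit.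
Unset Printing Implicit Defensive.

(** A realization of [H] is encoded as a word: the vertices of [H] come first, then the
    determination string. As [H] has no rungs, adjacency in the realization depends only on
    the two letters and on whether the positions are consecutive. Containment of a pathograph
    [F] is a monadic second-order property of this word: one guesses which vertex or urpath of
    [F] each position belongs to and where the urpaths start and end; that a class is an
    induced path is expressed by saying that it is a minimal set linking its two ends.
    Monadic second-order properties of words are regular, the set of determination strings is
    a concatenation of regular languages, and a fixed prefix only changes the initial state. *)

(** * Closure properties of regular languages *)

Section Regular.
Variable B : finType.
Implicit Types (L : seq B -> Prop) (w : seq B).

Definition regular L := exists M : dfa B, forall w, dfa_accepts M w <-> L w.

Lemma regular_ext L1 L2 : (forall w, L1 w <-> L2 w) -> regular L1 -> regular L2.
Proof. by move=> E [M hM]; exists M => w; rewrite hM. Qed.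

Lemma regular_dec L w : regular L -> L w \/ ~ L w.
Proof. by case=> M hM; case: (boolP (dfa_accepts M w)) => [|/negP]; rewrite hM; [left|right]. Qed.

Lemma regular_const (b : bool) : regular (fun=> b).
Proof. by exists (@DFA B unit tt (fun=> b) (fun=> fun=> tt)). Qed.

Lemma regular_not L : regular L -> regular (fun w => ~ L w).
Proof.
case=> M hM; exists (DFA (dfa_start M) [predC (@dfa_final B M)] (@dfa_trans B M)) => w.
by rewrite -hM; split=> /negP.
Qed.

Lemma regular_and L1 L2 : regular L1 -> regular L2 -> regular (fun w => L1 w /\ L2 w).
Proof.
case=> M1 h1 [M2 h2].
exists (@DFA B (dfa_state M1 * dfa_state M2)%type (dfa_start M1, dfa_start M2)
  (fun q => dfa_final q.1 && dfa_final q.2)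
  (fun q a => (dfa_trans q.1 a, dfa_trans q.2 a))) => w.
rewrite -h1 -h2 /dfa_accepts /=.
suff -> : forall q1 q2, foldl (fun q a => (@dfa_trans B M1 q.1 a, @dfa_trans B M2 q.2 a)) (q1, q2) w
   = (foldl (@dfa_trans B M1) q1 w, foldl (@dfa_trans B M2) q2 w).
  by split=> /andP.
by elim: w => //= a w IH q1 q2; rewrite IH.
Qed.

Lemma regular_prefix L p : regular L -> regular (fun w => L (p ++ w)).
Proof.
case=> M hM; exists (DFA (foldl (@dfa_trans B M) (dfa_start M) p)
  (@dfa_final B M) (@dfa_trans B M)) => w.
by rewrite -hM /dfa_accepts foldl_cat.
Qed.

(** Subset construction: run [M1] on the whole word and keep the set of states that [M2] can have
    reached over all cuts so far. Whenever [M1] is in a final state a new run of [M2] starts. *)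
Lemma regular_cat L1 L2 : regular L1 -> regular L2 ->
  regular (fun w => exists w1 w2, [/\ w = w1 ++ w2, L1 w1 & L2 w2]).
Proof.
case=> M1 h1 [M2 h2].
pose new (q : dfa_state M1) := [set q2 in pred1 (dfa_start M2) | dfa_final q].
pose step (s : dfa_state M1 * {set dfa_state M2}) a :=
  let q := dfa_trans s.1 a in (q, [set dfa_trans q2 a | q2 in s.2] :|: new q).
pose s0 := (dfa_start M1, new (dfa_start M1)).
exists (@DFA B (dfa_state M1 * {set dfa_state M2})%type s0
  (fun s => [exists q in s.2, dfa_final q]) step) => w.
have run : forall w, (foldl step s0 w).1 = foldl (@dfa_trans B M1) (dfa_start M1) w /\
  forall q, q \in (foldl step s0 w).2 <-> exists w1 w2,
    [/\ w = w1 ++ w2, dfa_accepts M1 w1 & foldl (@dfa_trans B M2) (dfa_start M2) w2 = q].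
  elim/last_ind=> [|v a [IH1 IH2]] /=.
    split=> // q; rewrite !inE; split.
      by case/andP=> /eqP -> F; exists [::], [::].
    by case=> [[|? ?]] [[|? ?]] [] //= _ A <-; rewrite eqxx.
  rewrite !foldl_rcons /= IH1; split=> // q; rewrite !inE; split.
    case/orP=> [/imsetP[q2 /IH2 [w1 [w2 [-> A <-]]] ->]|/andP[/eqP -> A]].
      by exists w1, (rcons w2 a); rewrite rcons_cat foldl_rcons.
    by exists (rcons v a), [::]; rewrite cats0 /dfa_accepts foldl_rcons.
  case=> w1 [w2 [+ A <-]]; case/lastP: w2 => [|w2 b].
    by rewrite cats0 => E; rewrite -foldl_rcons E eqxx orbC [dfa_final _]A.
  rewrite -rcons_cat => /rcons_inj [E ->]; apply/orP; left; rewrite foldl_rcons.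
  by apply/imsetP; eexists; [apply/IH2; exists w1, w2; split; first exact: E|].
rewrite /dfa_accepts /=; split.
  case/existsP=> q /andP[/(run w).2 [w1 [w2 [-> A E]]] F]; exists w1, w2.
  by split=> //; [apply/h1|apply/h2; rewrite /dfa_accepts E].
case=> w1 [w2 [E /h1 A /h2 F]]; apply/existsP.
exists (foldl (@dfa_trans B M2) (dfa_start M2) w2); apply/andP; split=> //.
by apply/(run w).2; exists w1, w2.
Qed.

(** Together with [onth w k] this gives the two letters around the gap [k], with [None] beyond
    either end of the word. *)
Definition letter_before w k := if k is j.+1 then onth w j else None.

Lemma letter_before_rcons w a k : k <= size w ->
  letter_before (rcons w a) k = letter_before w k.
Proof. by case: k => //= k lk; rewrite !onthE map_rcons nth_rcons size_map lk. Qed.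

Lemma onth_rcons w a k : onth (rcons w a) k =
  if k < size w then onth w k else if k == size w then Some a else None.
Proof. by rewrite !onthE map_rcons nth_rcons size_map. Qed.

(** The state holds the last letter and whether some earlier gap satisfied [R]. The gap after the
    last letter is recognized only when the word ends, so it is tested by the acceptance
    condition. *)
Lemma regular_consecutive (R : rel (option B)) :
  regular (fun w => exists2 k, k <= size w & R (letter_before w k) (onth w k)).
Proof.
pose step (s : option B * bool) a := (Some a, s.2 || R s.1 (Some a)).
exists (@DFA B (option B * bool)%type (None, false) (fun s => s.2 || R s.1 None) step) => w.
have run : forall w, (foldl step (None, false) w).1 = letter_before w (size w) /\
  ((foldl step (None, false) w).2 <-> exists2 k, k < size w & R (letter_before w k) (onth w k)).
  elim/last_ind=> [|v a [IH1 IH2]] /=; first by split=> //; split=> // -[].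
  rewrite !foldl_rcons size_rcons /= onth_rcons ltnn eqxx; split=> //; split.
    case/orP=> [/IH2 [k lk Rk]|].
      exists k; first exact: ltnW.
      by rewrite letter_before_rcons ?onth_rcons ?lk // ltnW.
    rewrite IH1 => Ra; exists (size v) => //.
    by rewrite letter_before_rcons // onth_rcons ltnn eqxx.
  case=> k; rewrite ltnS => lk; rewrite letter_before_rcons // onth_rcons.
  move: lk; rewrite leq_eqVlt => /orP[/eqP ->|lk].
    by rewrite ltnn eqxx IH1 => ->; rewrite orbT.
  by rewrite lk => Rk; apply/orP; left; apply/IH2; exists k.
have onthN : onth w (size w) = None by rewrite onthE nth_default ?size_map.
rewrite /dfa_accepts /=; split.
  case/orP=> [/(run w).2 [k lk Rk]|]; first by exists k => //; exact: ltnW.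
  by rewrite (run w).1 => Rw; exists (size w); rewrite ?onthN.
case=> k; rewrite leq_eqVlt => /orP[/eqP ->|lk Rk].
  by rewrite onthN (run w).1 => ->; rewrite orbT.
by apply/orP; left; apply/(run w).2; exists k.
Qed.

Lemma regular_has (P : pred B) : regular (has P).
Proof.
apply: regular_ext (regular_consecutive (fun _ y => if y is Some b then P b else false)).
move=> w; split=> [[k _]|/hasP[b /onthP[k Ek] Pb]].
  case E: (onth w k) => [b|] // Pb; apply/hasP; exists b => //.
  by apply/onthP; exists k.
exists k; last by rewrite Ek.
by rewrite leqNgt; apply/negP => /ltnW /onth_default; rewrite Ek.
Qed.

End Regular.

Lemma regular_map (B C : finType) (h : C -> B) L :
  regular L -> regular (fun w => L (map h w)).
Proof.
case=> M hM.
exists (DFA (dfa_start M) (@dfa_final B M) (fun q c => @dfa_trans B M q (h c))) => w.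
rewrite -hM /dfa_accepts /=.
suff -> : forall q, foldl (fun q c => @dfa_trans B M q (h c)) q w =
    foldl (@dfa_trans B M) q (map h w) by [].
by elim: w => /=.
Qed.

(** Subset construction: the second components are guessed, and the state is the set of states
    reached by all guesses. *)
Lemma regular_project (B C : finType) (L : seq (B * C) -> Prop) : regular L ->
  regular (fun w => exists2 s, size s = size w & L (zip w s)).
Proof.
case=> M hM.
pose step (S : {set dfa_state M}) b := [set dfa_trans q (b, c) | q in S, c in C].
exists (@DFA B {set dfa_state M} [set dfa_start M]
  (fun S => [exists q in S, dfa_final q]) step) => w.
have run : forall w q, q \in foldl step [set dfa_start M] w <->
   exists2 s, size s = size w & foldl (@dfa_trans _ M) (dfa_start M) (zip w s) = q.
  elim/last_ind=> [|v b IH] q /=.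
    rewrite inE; split=> [/eqP ->|]; first by exists [::].
    by case=> -[|? ?] //= _ <-.
  rewrite foldl_rcons size_rcons; split.
    case/imset2P=> q' c /IH [s Es Eq] _ ->; exists (rcons s c); first by rewrite size_rcons Es.
    by rewrite zip_rcons // foldl_rcons Eq.
  case; case/lastP=> // s c; rewrite size_rcons => -[Es].
  rewrite zip_rcons // foldl_rcons => <-; apply/imset2P.
  by eexists; last reflexivity; [apply/IH; exists s|].
rewrite /dfa_accepts /=; split.
  by case/existsP=> q /andP[/run [s Es Eq] Fq]; exists s => //; apply/hM; rewrite /dfa_accepts Eq.
case=> s Es /hM A; apply/existsP; eexists; apply/andP; split; last exact: A.
by apply/run; exists s.
Qed.

(* Monadic second-order properties of words: a word is a map ['I_n -> B], and a
   set variable is a further labelling of its positions. *)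
Definition definable (B : finType) (Phi : forall n, ('I_n -> B) -> Prop) :=
  exists2 L, regular L & forall n (f : 'I_n -> B), L (codom f) <-> Phi n f.

(** * Connectives and quantifiers for definable properties *)

Section Definable.
Variable B : finType.
Implicit Types Phi Psi : forall n, ('I_n -> B) -> Prop.

Lemma definable_ext Phi Psi : (forall n (f : 'I_n -> B), Phi n f <-> Psi n f) ->
  definable Phi -> definable Psi.
Proof. by move=> E [L rL hL]; exists L => // n f; rewrite hL. Qed.

(** An automaton decides the property. This justifies the classical reductions of implication,
    disjunction and the quantifiers constructively. *)
Lemma definable_dec Phi n (f : 'I_n -> B) : definable Phi -> Phi n f \/ ~ Phi n f.
Proof. by case=> L rL <-; exact: regular_dec. Qed.

Lemma definable_not Phi : definable Phi -> definable (fun n f => ~ Phi n f).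
Proof. by case=> L rL hL; exists (fun w => ~ L w) => [|n f]; [exact: regular_not|rewrite hL]. Qed.

Lemma definable_and Phi Psi : definable Phi -> definable Psi ->
  definable (fun n f => Phi n f /\ Psi n f).
Proof.
move=> [L rL hL] [K rK hK]; exists (fun w => L w /\ K w) => [|n f]; first exact: regular_and.
by rewrite hL hK.
Qed.

Lemma definable_const (b : bool) : definable (fun n (f : 'I_n -> B) => b).
Proof. by exists (fun=> b) => //; exact: regular_const. Qed.

Lemma definable_imply Phi Psi : definable Phi -> definable Psi ->
  definable (fun n f => Phi n f -> Psi n f).
Proof.
move=> dP dQ; apply: (@definable_ext (fun n f => ~ (Phi n f /\ ~ Psi n f))).
  move=> n f; split=> [h p|h [p]]; last by apply; exact: h.
  by case: (definable_dec f dQ) => // q; case: h.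
by apply/definable_not/definable_and => //; exact: definable_not.
Qed.

Lemma definable_or Phi Psi : definable Phi -> definable Psi ->
  definable (fun n f => Phi n f \/ Psi n f).
Proof.
move=> dP dQ; apply: (@definable_ext (fun n f => ~ Phi n f -> Psi n f)).
  move=> n f; split=> [h|[] //].
  by case: (definable_dec f dP) => [|/h]; [left|right].
by apply: definable_imply => //; exact: definable_not.
Qed.

Lemma definable_forall_fin (I : finType) (Phi : I -> forall n, ('I_n -> B) -> Prop) :
  (forall i, definable (Phi i)) -> definable (fun n f => forall i, Phi i n f).
Proof.
move=> dP; apply: (@definable_ext (fun n f => forall i, i \in enum I -> Phi i n f)).
  by move=> n f; split=> h i; [apply: h; rewrite mem_enum|move=> _; exact: h].
elim: (enum I) => [|i s IH].
  by apply: (@definable_ext (fun n f => true)) => //; exact: definable_const.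
apply: (@definable_ext (fun n f => Phi i n f /\ forall i, i \in s -> Phi i n f)).
  move=> n f; split=> [[h1 h2] j|h].
    by rewrite inE => /orP[/eqP ->//|]; exact: h2.
  by split=> [|j js]; apply: h; rewrite inE ?eqxx ?js ?orbT.
exact: definable_and.
Qed.

Lemma definable_exists_fin (I : finType) (Phi : I -> forall n, ('I_n -> B) -> Prop) :
  (forall i, definable (Phi i)) -> definable (fun n f => exists i, Phi i n f).
Proof.
move=> dP; have dN : definable (fun n f => forall i, ~ Phi i n f).
  by apply: definable_forall_fin => i; exact: definable_not.
apply: (@definable_ext (fun n f => ~ forall i, ~ Phi i n f)); last exact: definable_not.
move=> n f; split=> [h|[i h]]; last by move/(_ i).
(* Decidability turns every instance into a boolean, so that a witness can be searched for in the
   finite type. *)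
have /(@fin_all_exists I (fun=> bool)) [p hp] : forall i, exists b : bool, b <-> Phi i n f.
  by move=> i; case: (definable_dec f (dP i)) => d; [exists true|exists false].
case: (pickP p) => [i /hp|p0]; first by exists i.
by case: h => i /hp; rewrite p0.
Qed.

Lemma onth_codom n (f : 'I_n -> B) (i : 'I_n) : onth (codom f) i = Some (f i).
Proof.
by rewrite /codom /image_mem onth_map onthE (nth_map i) ?size_enum_ord // nth_ord_enum.
Qed.

Lemma definable_some (P : pred B) : definable (fun n f => exists i, P (f i)).
Proof.
exists (has P) => [|n f]; first exact: regular_has.
split=> [/hasP[_ /codomP[i ->]]|[i Pi]]; first by exists i.
by apply/hasP; exists (f i) => //; exact: codom_f.
Qed.

Lemma definable_consecutive (R : rel B) :
  definable (fun n f => exists i j : 'I_n, i.+1 == j /\ R (f i) (f j)).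
Proof.
(* The gaps at the two ends of the word are excluded. *)
pose R' (x y : option B) := if x is Some a then if y is Some b then R a b else false else false.
exists (fun w => exists2 k, k <= size w & R' (letter_before w k) (onth w k)).
  exact: regular_consecutive.
move=> n f; split.
  case=> -[|k] //; rewrite size_codom card_ord => lk.
  rewrite /letter_before /R' (onth_codom f (Ordinal lk)).
  case E: (onth (codom f) k.+1) => [b|] // Rb; have lk1 : k.+1 < n.
    by rewrite ltnNge -[n]card_ord -(size_codom f); apply/negP => /onth_default; rewrite E.
  have := @onth_codom n f (Ordinal lk1); rewrite [onth _ _]E => -[Eb].
  by exists (Ordinal lk), (Ordinal lk1); rewrite -Eb.
case=> i [j [/eqP Ej Rij]]; exists j; first by rewrite size_codom card_ord ltnW.
by rewrite onth_codom -Ej /= onth_codom.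
Qed.
End Definable.

Section Labellings.
Variables (B C : finType) (Phi : forall n, ('I_n -> B) -> ('I_n -> C) -> Prop).
Hypothesis dPhi : definable (fun n (f : 'I_n -> B * C) => Phi (fst \o f) (snd \o f)).

(** A labelling of the positions is a second word of the same length, so the quantifier becomes a
    projection from the product alphabet. *)
Lemma definable_exists : definable (fun n f => exists h, @Phi n f h).
Proof.
case: dPhi => L rL hL; exists (fun w => exists2 s, size s = size w & L (zip w s)).
  exact: regular_project.
move=> n f; have zipE (h : 'I_n -> C) :
    zip (codom f) (codom h) = codom (fun i => (f i, h i)).
  by rewrite /codom /image_mem zip_map.
split=> [[s Es]|[h Ph]].
  have Es' : size s == n by rewrite Es size_codom card_ord.
  have -> : s = codom (tnth (Tuple Es')).
    by rewrite /codom /image_mem map_tnth_enum.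
  by rewrite zipE => /hL; exists (tnth (Tuple Es')).
by exists (codom h); rewrite ?size_codom // zipE; apply/hL.
Qed.
End Labellings.

Lemma definable_forall (B C : finType) (Phi : forall n, ('I_n -> B) -> ('I_n -> C) -> Prop) :
  definable (fun n (f : 'I_n -> B * C) => Phi n (fst \o f) (snd \o f)) ->
  definable (fun n f => forall h, Phi n f h).
Proof.
move=> dPhi; apply: (@definable_ext _ (fun n f => ~ exists h, ~ Phi n f h)).
  move=> n f; split=> [h g|h [g]]; last by apply; exact: h.
  case: (definable_dec (fun i => (f i, g i)) dPhi) => // Ng.
  by case: h; exists g.
by apply: definable_not; apply: definable_exists; exact: definable_not.
Qed.

(* A set has at most one element iff no colouring with two colours uses both on it. *)
Lemma definable_unique (B : finType) (P : pred B) :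
  definable (fun n f => forall i j : 'I_n, P (f i) -> P (f j) -> i = j).
Proof.
apply: (@definable_ext _ (fun n f => forall h : 'I_n -> bool,
    ~ ((exists i, P (f i) && h i) /\ (exists i, P (f i) && ~~ h i)))).
  move=> n f; split=> [H i j Pi Pj|H h [[i /andP[Pi hi]] [j /andP[Pj]]]].
    apply/eqP/negPn/negP => Nij; apply: (H (pred1 i)); split.
      by exists i; rewrite Pi /= eqxx.
    by exists j; rewrite Pj /= eq_sym.
  by rewrite (H j i) ?hi.
apply: definable_forall; apply: definable_not; apply: definable_and.
  exact: (definable_some (fun b : B * bool => P b.1 && b.2)).
exact: (definable_some (fun b : B * bool => P b.1 && ~~ b.2)).
Qed.

Section InducedPaths.
Variables (T : finType) (e : rel T).
Implicit Types C A Z D : T -> bool.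

(* Monadic second-order way to say that some walk inside C leads from A to Z. *)
Definition linked C A Z := forall D,
  (forall x, C x && A x -> D x) ->
  (forall x y, e x y -> [&& C x, C y & D x] -> D y) ->
  exists x, [&& C x, Z x & D x].

Definition minimally_linked C A Z :=
  linked C A Z /\ forall C', (forall x, C' x -> C x) -> linked C' A Z -> forall x, C x -> C' x.

(** The path has [k] edges; [q] is total for convenience and only its values up to [k] count. *)
Definition induced_path C A Z k (q : nat -> T) :=
  [/\ A (q 0), Z (q k), forall x, C x <-> exists2 i, i <= k & x = q i,
      {in [pred i | i <= k] &, injective q} &
      forall i j, i <= k -> j <= k -> e (q i) (q j) = (i.+1 == j) || (j.+1 == i)].

Lemma walk_linked C A Z k (q : nat -> T) :
  A (q 0) -> Z (q k) -> (forall i, i <= k -> C (q i)) ->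
  (forall i, i < k -> e (q i) (q i.+1)) -> linked C A Z.
Proof.
move=> Aq Zq Cq eq D DA Dcl; exists (q k); rewrite Cq // Zq /=.
suff Dq : forall i, i <= k -> D (q i) by exact: Dq.
elim=> [|i IH] lik; first by apply: DA; rewrite Cq.
by apply: (Dcl (q i)); rewrite ?eq // ?Cq ?IH // ltnW.
Qed.

(** Apply the hypothesis to the set of vertices reachable from [A] inside [C], then shorten the path
    found to one without repetitions. *)
Lemma linked_walk C A Z : linked C A Z -> exists k q,
  [/\ A (q 0), Z (q k), forall i, i <= k -> C (q i), {in [pred i | i <= k] &, injective q} &
      forall i, i < k -> e (q i) (q i.+1)].
Proof.
pose r := [rel x y | [&& C x, C y & e x y]].
case/(_ (fun y => [exists x, [&& C x, A x & connect r x y]])).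
- by move=> x CAx; apply/existsP; exists x; rewrite andbA CAx connect0.
- move=> x y exy /and3P[Cx Cy /existsP[z /and3P[Cz Az rzx]]]; apply/existsP; exists z.
  by rewrite Cz Az (connect_trans rzx) // connect1 //= Cx Cy.
move=> z /and3P[Cz Zz /existsP[x /and3P[Cx Ax /connectP[p' rp' Ez]]]].
move: Zz; rewrite {z Cz}Ez; case/shortenP: rp' => p rp up _ Zz.
exists (size p), (nth x (x :: p)); split=> //.
- by rewrite nth_last.
- elim=> [|i IH] // lip.
  by have /and3P[] := (pathP x rp) i lip.
- by move=> i j; rewrite !inE => li lj /eqP; rewrite nth_uniq //= => /eqP.
- by move=> i li; have /and3P[] := (pathP x rp) i li.
Qed.

Hypotheses (e_sym : symmetric e) (e_irr : irreflexive e).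

(* If the vertex set of a path is minimal among the sets linking its ends, the path
   has no chord: a chord gives a walk that avoids a vertex. *)
Lemma minimally_linked_path C A Z :
  minimally_linked C A Z -> exists k q, induced_path C A Z k q.
Proof.
case=> /linked_walk [k [q [Aq Zq Cq qI eq]]] Cmin.
exists k, q; split=> //.
  move=> x; split=> [Cx|[i li ->]]; last exact: Cq.
  (* The vertices of the walk alone link the ends, so by minimality they exhaust [C]. *)
  pose C' x := [exists i : 'I_k.+1, x == q i].
  have /existsP[i /eqP ->] : C' x; last by exists i; rewrite // -ltnS.
  apply: Cmin Cx => [y /existsP[i /eqP ->]|]; first by rewrite Cq // -ltnS.
  apply: (@walk_linked _ _ _ k q) => // i li; apply/existsP.
  by exists (inord i); rewrite inordK.
have chordless i j : i.+1 < j -> j <= k -> ~~ e (q i) (q j).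
  move=> lij lj; apply/negP => eij.
  (* Without the positions strictly between [i] and [j] the ends are still linked, through the
     chord. *)
  pose C' x := [exists l : 'I_k.+1, ((l <= i) || (j <= l)) && (x == q l)].
  have C'q l : l <= k -> (l <= i) || (j <= l) -> C' (q l).
    by move=> lk h; apply/existsP; exists (inord l); rewrite inordK // h eqxx.
  have /existsP[l /andP[hl /eqP El]] : C' (q i.+1).
    apply: Cmin; last by apply: Cq; lia.
      by move=> x /existsP[l /andP[_ /eqP ->]]; rewrite Cq // -ltnS.
    (* The walk jumps from [i] to [j], so all later indices are shifted by [j - i.+1]. *)
    apply: (@walk_linked _ _ _ (k - (j - i.+1))
      (fun l => if l <= i then q l else q (l + (j - i.+1)))) => //.
    - rewrite ifF; last lia.
      by have -> : k - (j - i.+1) + (j - i.+1) = k by lia.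
    - by move=> l lk; case: ifP => li; apply: C'q; lia.
    - move=> l lk; case: ifP => li; case: ifP => li1.
      + by apply: eq; lia.
      + have -> : l = i by lia.
        by have -> : i.+1 + (j - i.+1) = j by lia.
      + by lia.
      + by rewrite addSn; apply: eq; lia.
  have ll := ltn_ord l.
  by have := qI i.+1 l; rewrite !inE => /(_ _ _ El); lia.
move=> i j li lj; case: (ltngtP i j) => [lij|lji|<-].
- have [Ej|Nj] := eqVneq i.+1 j; first by rewrite -Ej eq //; lia.
  by rewrite (negbTE (chordless i j _ _)) //; lia.
- rewrite e_sym; have [Ei|Ni] := eqVneq j.+1 i; first by rewrite -Ei eq //; lia.
  by rewrite (negbTE (chordless j i _ _)) //; lia.
- by rewrite e_irr; lia.
Qed.

(** If a linking subset missed [q j], the vertices before [q j] would contain its start and be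
    closed under adjacency inside the subset, since the path has no chords; yet they do not contain
    the unique end. *)
Lemma path_minimally_linked C A Z k q :
  (forall x y, C x && A x -> C y && A y -> x = y) ->
  (forall x y, C x && Z x -> C y && Z y -> x = y) ->
  induced_path C A Z k q -> minimally_linked C A Z.
Proof.
move=> uA uZ [Aq Zq Cq qI eq]; have Cqi i : i <= k -> C (q i) by move=> li; apply/Cq; exists i.
split; first by apply: (@walk_linked _ _ _ k q) => // i li; rewrite eq ?eqxx // ltnW.
move=> C' sC lC _ /Cq [j lj ->]; apply/negPn/negP => NC.
have [] := lC (fun x => [exists i : 'I_j, x == q i]).
- move=> x /andP[/[dup] C'x /sC Cx Ax].
  have Ex : x = q 0 by apply: uA; rewrite ?Cx ?Cqi.
  case: j lj NC => [|j] lj NC; first by rewrite Ex (negbTE NC) in C'x.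
  by apply/existsP; exists ord0; rewrite Ex.
- move=> x y exy /and3P[C'x C'y /existsP[i /eqP Ex]]; have /Cq [l ll Ey] := sC _ C'y.
  have li := ltn_ord i; have Njl : l != j by apply: contra NC => /eqP <-; rewrite -Ey.
  have llj : l < j.
    by move: exy; rewrite Ex Ey eq //; lia.
  by apply/existsP; exists (Ordinal llj); rewrite Ey.
- move=> x /and3P[/sC Cx Zx /existsP[i /eqP Ex]].
  have Ek : x = q k by apply: uZ; rewrite ?Cx ?Cqi.
  have li := ltn_ord i; rewrite Ex in Ek.
  by have := qI i k; rewrite !inE => /(_ _ _ Ek); lia.
Qed.
End InducedPaths.

(** * Containment of a pathograph expressed by labels on the host graph *)

Lemma contains_pg_embed (T T' : finType) (e : rel T) (e' : rel T') (h : T -> T') F :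
  injective h -> (forall x y, e' (h x) (h y) = e x y) ->
  contains_pg e F -> contains_pg e' F.
Proof.
move=> hI he [m [X [f [rX fI fe]]]]; exists m, X, (h \o f); split=> //.
  exact: inj_comp.
by move=> x y; rewrite /= he fe.
Qed.

Lemma radj_sym (F : pathograph) (m : 'I_(pg_nu F) -> nat) (X : rel (rvert F m)) :
  symmetric (radj X).
Proof. by move=> x y; rewrite /radj orbCA [X x y || _]orbC. Qed.

(** Extra edges are recorded only in the direction from a vertex to an internal vertex, so the
    reversed instance of [X] is empty. *)
Lemma radj_spoke (F : pathograph) (m : 'I_(pg_nu F) -> nat) (X : rel (rvert F m))
  v u (i : 'I_(m u)) :
  is_realization X -> radj X (inl v) (ivert i) =
    [|| (v == pg_a F u) && (i == 0 :> nat), (v == pg_b F u) && (i.+1 == m u) |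
        X (inl v) (ivert i)].
Proof.
case=> _ XA _ _; rewrite /radj /=.
case: (X (ivert i) (inl v)) (XA (ivert i) (inl v)) => [/(_ isT)//|_].
by rewrite orbF -orbA.
Qed.

Section Model.
Variable F : pathograph.

(* The vertex or urpath of F to which a vertex of the host graph belongs, if any, and
   whether it is the first or the last internal vertex of that urpath. *)
Definition pg_label : finType :=
  (option ('I_(pg_nv F) + 'I_(pg_nu F)) * bool * bool)%type.
Implicit Type l : pg_label.

Definition on_vertex v l := l.1.1 == Some (inl v).
Definition on_urpath u l := l.1.1 == Some (inr u).
Definition is_first l := l.1.2.
Definition is_last l := l.2.

(** The clauses say in turn: each vertex has one copy; the first and last vertices of an urpath are
    unique; each urpath class is an induced path; then come the edges, the admissible edges between
    vertices and urpaths, the forced ones, the spokes and the rungs. Existence of first and last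
    vertices follows from linkedness. Each edge condition concerns a single adjacent pair, which
    keeps it within reach of automata. *)
Definition pg_model (T : finType) (e : rel T) (l : T -> pg_label) : Prop :=
  (forall v, (exists x, on_vertex v (l x)) /\
     (forall x y, on_vertex v (l x) -> on_vertex v (l y) -> x = y)) /\
  (forall u, (forall x y, on_urpath u (l x) && is_first (l x) ->
                on_urpath u (l y) && is_first (l y) -> x = y) /\
     (forall x y, on_urpath u (l x) && is_last (l x) ->
                on_urpath u (l y) && is_last (l y) -> x = y)) /\
  (forall u, minimally_linked e (on_urpath u \o l) (is_first \o l) (is_last \o l)) /\
  (forall v w, pg_E F v w <-> exists x y, e x y /\ on_vertex v (l x) && on_vertex w (l y)) /\
  (forall v u, ~ exists x y, e x y /\ [&& on_vertex v (l x), on_urpath u (l y) &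
     ~~ [|| pg_S F v u, (v == pg_a F u) && is_first (l y) | (v == pg_b F u) && is_last (l y)]]) /\
  (forall u, (exists x y, e x y /\
      [&& on_vertex (pg_a F u) (l x), on_urpath u (l y) & is_first (l y)]) /\
     (exists x y, e x y /\
      [&& on_vertex (pg_b F u) (l x), on_urpath u (l y) & is_last (l y)])) /\
  (forall v u, pg_S F v u -> exists x y, e x y /\ on_vertex v (l x) && on_urpath u (l y)) /\
  (forall u u', u != u' ->
     (pg_R F u u' <-> exists x y, e x y /\ on_urpath u (l x) && on_urpath u' (l y))).

Variables (T : finType) (e : rel T).
Hypothesis F_wf : pg_wf F.

Lemma contains_pg_model : contains_pg e F -> exists lam, pg_model e lam.
Proof.
case: F_wf => E_sym _ R_sym R_irr _.
case=> m [X [f [rX fI fe]]]; have [m0 XA XS XR] := rX.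
pose lab (x : rvert F m) : pg_label := match x with
  | inl v => (Some (inl v), false, false)
  | inr p => (Some (inr (tag p)), nat_of_ord (tagged p) == 0, (tagged p).+1 == m (tag p))
  end.
(* Host vertices outside the image of [f] belong to no class. *)
pose l z := oapp lab (None, false, false) [pick x | f x == z].
have lf x : l (f x) = lab x.
  rewrite /l; case: pickP => [y /eqP /fI -> //|/(_ x)]; by rewrite eqxx.
have lv v z : on_vertex v (l z) -> z = f (inl v).
  rewrite /l; case: pickP => [[w|p] /eqP <-|] //=; rewrite /on_vertex /=.
  by move=> /eqP [->].
have lu u z : on_urpath u (l z) -> exists i : 'I_(m u), z = f (ivert i).
  rewrite /l; case: pickP => [[w|[u' i]] /eqP <-|] //=; rewrite /on_urpath /=.
  by move=> /eqP [<-]; exists i.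
have lvf v : on_vertex v (l (f (inl v))) by rewrite lf /on_vertex eqxx.
have luf u (i : 'I_(m u)) : on_urpath u (l (f (ivert i))) by rewrite lf /on_urpath eqxx.
have lff u (i : 'I_(m u)) : is_first (l (f (ivert i))) = (i == 0 :> nat) by rewrite lf.
have llf u (i : 'I_(m u)) : is_last (l (f (ivert i))) = (i.+1 == m u) by rewrite lf.
have uf u : forall x y, on_urpath u (l x) && is_first (l x) ->
                on_urpath u (l y) && is_first (l y) -> x = y.
  move=> x y /andP[/lu [i ->] +] /andP[/lu [j ->] +]; rewrite !lff => /eqP Ei /eqP Ej.
  by congr (f (ivert _)); apply: val_inj; rewrite /= Ei Ej.
have ul u : forall x y, on_urpath u (l x) && is_last (l x) ->
                on_urpath u (l y) && is_last (l y) -> x = y.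
  move=> x y /andP[/lu [i ->] +] /andP[/lu [j ->] +]; rewrite !llf => /eqP Ei /eqP Ej.
  by congr (f (ivert _)); apply: val_inj; apply: succn_inj; rewrite /= Ei Ej.
have radj_uu u (i j : 'I_(m u)) : radj X (ivert i) (ivert j) = (i.+1 == j) || (j.+1 == i).
  rewrite /radj /= eqxx /=.
  case: (X (ivert i) (ivert j)) (XA (ivert i) (ivert j)) => [/(_ isT)|_].
    by rewrite /= R_irr.
  case: (X (ivert j) (ivert i)) (XA (ivert j) (ivert i)) => [/(_ isT)|_].
    by rewrite /= R_irr.
  by rewrite !orbF.
exists l; split; last split; last split; last split; last split; last split; last split.
- by move=> v; split=> [|x y /lv -> /lv ->] //; exists (f (inl v)).
- by move=> u; split; [exact: uf|exact: ul].
- move=> u; pose i0 := Ordinal (m0 u).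
  (* [insubd] only makes the path total on the natural numbers; its default lies beyond the last
     index [(m u).-1]. *)
  apply: (@path_minimally_linked _ _ _ _ _ (m u).-1 (fun j => f (ivert (insubd i0 j)))).
  + exact: uf.
  + exact: ul.
  have vq j : j <= (m u).-1 -> val (insubd i0 j) = j.
    by move=> lj; rewrite val_insubd ifT //; have := m0 u; lia.
  split.
  + by rewrite /= lff; apply/eqP; apply: vq.
  + by rewrite /= llf; apply/eqP; rewrite [nat_of_ord _]vq // prednK.
  + move=> x /=; split=> [/lu [i ->]|[i li ->]] //.
    exists i; first by have := ltn_ord i; lia.
    by congr (f (ivert _)); apply: val_inj; rewrite vq //; have := ltn_ord i; lia.
  + move=> i j; rewrite !inE => li lj /fI [] /eqP; rewrite eq_Tagged /= => /eqP /(congr1 val).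
    by rewrite !vq.
  + by move=> i j li lj; rewrite fe radj_uu ![nat_of_ord _]vq.
- move=> v w; split=> [Evw|[x [y [exy /andP[/lv Ex /lv Ey]]]]].
    by exists (f (inl v)), (f (inl w)); rewrite fe /radj /= Evw !lvf.
  move: exy; rewrite Ex Ey fe /radj /= => /or4P[||/XA|/XA] //; by rewrite E_sym.
- move=> v u [x [y [exy /and3P[/lv Ex /lu [i Ey]]]]].
  move: exy; rewrite Ex Ey fe radj_spoke // lff llf.
  by case/or3P=> [->|->|/XA /= ->]; rewrite ?orbT.
- move=> u; split.
    exists (f (inl (pg_a F u))), (f (ivert (Ordinal (m0 u)))).
    by rewrite fe radj_spoke // lvf luf lff !eqxx.
  have lm : (m u).-1 < m u by rewrite prednK.
  exists (f (inl (pg_b F u))), (f (ivert (Ordinal lm))).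
  by rewrite fe radj_spoke // lvf luf llf /= prednK // !eqxx orbT.
- move=> v u /XS [i Xi]; exists (f (inl v)), (f (ivert i)).
  by rewrite fe radj_spoke // Xi !orbT lvf luf.
- move=> u u' Nu; split=> [/XR [i [j Xij]]|[x [y [exy /andP[/lu [i Ex] /lu [j Ey]]]]]].
    exists (f (ivert i)), (f (ivert j)); rewrite fe luf luf; split=> //.
    by rewrite /radj; case/orP: Xij => ->; rewrite !orbT.
  move: exy; rewrite Ex Ey fe /radj /= (negbTE Nu) (eq_sym u' u) (negbTE Nu) /=.
  by case/orP=> /XA //=; rewrite R_sym.
Qed.

Hypotheses (e_sym : symmetric e) (e_irr : irreflexive e).

Lemma model_contains_pg : (exists lam, pg_model e lam) -> contains_pg e F.
Proof.
case: F_wf => E_sym _ R_sym R_irr _.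
case=> l [M1 [M2 [M3 [M4 [M5 [M6 [M7 M8]]]]]]].
have /fin_all_exists [g hg] := fun v => (M1 v).1.
have gv v x : on_vertex v (l x) -> x = g v by move/((M1 v).2); apply.
have /fin_all_exists [k /fin_all_exists [q hq]] :=
  fun u => minimally_linked_path e_sym e_irr (M3 u).
have lq u i : i <= k u -> on_urpath u (l (q u i)).
  by move=> li; case: (hq u) => _ _ C _ _; apply/C; exists i.
have ql u x : on_urpath u (l x) -> exists2 i, i <= k u & x = q u i.
  by move=> h; case: (hq u) => _ _ C _ _; apply/C.
have qI u i j : i <= k u -> j <= k u -> q u i = q u j -> i = j.
  by case: (hq u) => _ _ _ I _ li lj /I; apply.
have eqq u i j : i <= k u -> j <= k u -> e (q u i) (q u j) = (i.+1 == j) || (j.+1 == i).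
  by case: (hq u) => _ _ _ _; apply.
have fq u i : i <= k u -> is_first (l (q u i)) = (i == 0).
  case: (hq u) => F0 _ _ _ _ li; apply/idP/eqP => [Fi|->]; last exact: F0.
  by apply: (@qI u) => //; apply: (M2 u).1; rewrite ?lq ?Fi.
have eq u i : i <= k u -> is_last (l (q u i)) = (i == k u).
  case: (hq u) => _ F0 _ _ _ li; apply/idP/eqP => [Fi|->]; last exact: F0.
  by apply: (@qI u) => //; apply: (M2 u).2; rewrite ?lq ?Fi.
(* A path with [k u] edges has one more vertex. *)
pose m u := (k u).+1.
pose f (x : rvert F m) := match x with inl v => g v | inr p => q (tag p) (tagged p) end.
(* All host edges at allowed pairs are taken; they may repeat structural edges. *)
pose X : rel (rvert F m) := fun x y => rallowed x y && e (f x) (f y).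
have lk u (i : 'I_(m u)) : i <= k u by have := ltn_ord i; rewrite ltnS.
have e_vu v u (i : 'I_(m u)) : e (g v) (q u i) = radj X (inl v) (ivert i).
  rewrite /radj /= orbF /X /= eqSS; apply/idP/idP => [evi|].
    have [Svu|NS] := boolP (pg_S F v u); first by rewrite evi orbT.
    (* An edge that is neither at a spoke nor at an end of the urpath violates the clause on
       admissible edges. *)
    rewrite orbF; have [//|N] := boolP (_ || _); case: (M5 v u); exists (g v), (q u i).
    by rewrite hg lq //= (negbTE NS) fq // eq //= (negbTE N).
  case/orP=> [|/andP[] //].
  case/orP=> /andP[/eqP -> /eqP ->].
    have [[x [y [exy /and3P[/gv Ex /ql [j lj Ey] Fy]]]] _] := M6 u.
    by move: Fy; rewrite Ey fq // => /eqP Ej; rewrite -Ex -Ej -Ey.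
  have [_ [x [y [exy /and3P[/gv Ex /ql [j lj Ey] Fy]]]]] := M6 u.
  by move: Fy; rewrite Ey eq // => /eqP Ej; rewrite -Ex -Ej -Ey.
exists m, X, f; split.
- split=> //.
  + by move=> x y /andP[].
  + move=> v u Svu; have [x [y [exy /andP[/gv Ex /ql [i li Ey]]]]] := M7 v u Svu.
    by exists (Ordinal (li : i < m u)); rewrite /X /= Svu -Ex -Ey.
  + move=> u u' Ru; have [Eu|Nu] := eqVneq u u'; first by rewrite Eu R_irr in Ru.
    have [x [y [exy /andP[/ql [i li Ex] /ql [j lj Ey]]]]] := (M8 u u' Nu).1 Ru.
    exists (Ordinal (li : i < m u)), (Ordinal (lj : j < m u')).
    by rewrite /X /= Ru -Ex -Ey exy.
(* The label of an image recovers its vertex or urpath, so only two indices on one urpath remain to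
   be compared. *)
- have cls x : (l (f x)).1.1 = Some (match x with inl v => inl v | inr p => inr (tag p) end).
    by case: x => [v|[u i]] /=; apply/eqP; [apply: hg|apply: lq].
  move=> x y Exy; have := cls x; rewrite Exy cls.
  case: x Exy => [v|[u i]]; case: y => [w|[u' j]] //= E [Ew]; first by rewrite Ew.
  case: u / Ew i E => i /qI Eij; congr (inr (Tagged _ _)).
  by apply: val_inj; rewrite /= Eij.
- case=> [v|[u i]] [w|[u' j]] /=.
  + rewrite /radj /= /X /= !orbF E_sym orbb; apply/idP/idP => [evw|].
      by apply/M4; exists (g w), (g v); rewrite e_sym evw !hg.
    by move/M4 => [x [y [exy /andP[/gv Ex /gv Ey]]]]; rewrite e_sym -Ex -Ey.
  + exact: e_vu.
  + by rewrite e_sym radj_sym; exact: e_vu.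
  + rewrite /radj /X /=; have [Eu|Nu] := eqVneq u u'.
      by case: u' / Eu j => j; rewrite R_irr /= !orbF eqq.
    rewrite /= R_sym (e_sym (q u' j)) orbb; apply/idP/andP => [euu|[] //]; split=> //.
    rewrite R_sym; apply/(M8 u u' Nu); exists (q u i), (q u' j).
    by rewrite !lq.
Qed.

End Model.

(** * Graphs defined by words, and definability of containment *)

Section WordGraph.
Variables (A : finType) (far near : rel A).

(** [far] joins letters at any distance, [near] only letters at consecutive positions. *)
Definition word_adj n (a : 'I_n -> A) : rel 'I_n := fun i j =>
  far (a i) (a j) || near (a i) (a j) && ((i.+1 == j) || (j.+1 == i)).

(** For [far] pairs the positions are irrelevant, so it suffices that both letters of one of
    finitely many pairs occur. For [near] pairs the gaps are inspected, once in each order. *)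
Lemma definable_adj (B : finType) (pr : B -> A) (P : rel B) :
  definable (fun n (f : 'I_n -> B) =>
    exists i j, word_adj (pr \o f) i j /\ P (f i) (f j)).
Proof.
pose N b c := near (pr b) (pr c) && P b c.
apply: (@definable_ext _ (fun n f =>
  (exists bc : B * B, (exists i, far (pr bc.1) (pr bc.2) && P bc.1 bc.2 && (f i == bc.1)) /\
     (exists j, f j == bc.2)) \/
  ((exists i j : 'I_n, i.+1 == j /\ N (f i) (f j)) \/
   (exists i j : 'I_n, i.+1 == j /\ N (f j) (f i))))).
  move=> n f; split.
    case=> [[[b c] /= [[i /andP[/andP[Fbc Pbc] /eqP Ei]] [j /eqP Ej]]]|[]].
    - by exists i, j; rewrite /word_adj /= Ei Ej Fbc.
    - by case=> i [j [Eij /andP[Nij Pij]]]; exists i, j; rewrite /word_adj /= Nij Eij orbT.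
    - by case=> i [j [Eij /andP[Nij Pij]]]; exists j, i; rewrite /word_adj /= Nij Eij !orbT.
  case=> i [j [/orP[/= Fij|/andP[/= Nij /orP[Eij|Eij]]] Pij]].
  - by left; exists (f i, f j); split; [exists i; rewrite /= Fij Pij eqxx|exists j].
  - by right; left; exists i, j; rewrite /N Nij.
  - by right; right; exists j, i; rewrite /N Nij.
apply: definable_or; last apply: definable_or.
- apply: definable_exists_fin => bc; apply: definable_and.
    exact: (definable_some (fun b => far (pr bc.1) (pr bc.2) && P bc.1 bc.2 && (b == bc.1))).
  exact: (definable_some (fun b => b == bc.2)).
- exact: definable_consecutive.
- exact: (definable_consecutive (fun b c => N c b)).
Qed.

Lemma definable_adj_all (B : finType) (pr : B -> A) (P Q : rel B) :
  definable (fun n (f : 'I_n -> B) =>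
    forall i j, word_adj (pr \o f) i j -> P (f i) (f j) -> Q (f i) (f j)).
Proof.
apply: definable_ext (definable_not (definable_adj pr (fun b c => P b c && ~~ Q b c))).
move=> n f; split=> [H i j Aij Pij|H [i [j [/H PQ /andP[/PQ ->]]]] //].
by apply/negPn/negP => NQ; case: H; exists i, j; rewrite Pij.
Qed.

Lemma definable_every (B : finType) (P Q : pred B) :
  definable (fun n (f : 'I_n -> B) => forall i, P (f i) -> Q (f i)).
Proof.
apply: definable_ext (definable_not (definable_some (fun b => P b && ~~ Q b))).
move=> n f; split=> [H i Pi|H [i /andP[/H ->]]] //.
by apply/negPn/negP => NQ; case: H; exists i; rewrite Pi.
Qed.

(** The quantified set becomes an additional boolean in each letter; every clause then concerns one
    position or one adjacent pair. *)
Lemma definable_linked (B : finType) (pr : B -> A) (C S Z : pred B) :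
  definable (fun n (f : 'I_n -> B) =>
    linked (word_adj (pr \o f)) (C \o f) (S \o f) (Z \o f)).
Proof.
apply: definable_forall; apply: definable_imply; last apply: definable_imply.
- exact: (definable_every (fun b : B * bool => C b.1 && S b.1) snd).
- exact: (definable_adj_all (pr \o fst) (fun b c : B * bool => [&& C b.1, C c.1 & b.2])
    (fun _ c => c.2)).
- exact: (definable_some (fun b : B * bool => [&& C b.1, Z b.1 & b.2])).
Qed.

Lemma definable_minimally_linked (B : finType) (pr : B -> A) (C S Z : pred B) :
  definable (fun n (f : 'I_n -> B) =>
    minimally_linked (word_adj (pr \o f)) (C \o f) (S \o f) (Z \o f)).
Proof.
apply: definable_and; first exact: definable_linked.
apply: definable_forall; apply: definable_imply; last apply: definable_imply.
- exact: (definable_every snd (C \o fst)).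
- exact: (definable_linked (pr \o fst) (fun b : B * bool => b.2) (S \o fst) (Z \o fst)).
- exact: (definable_every (C \o fst) snd).
Qed.

Hypotheses (far_sym : symmetric far) (far_irr : irreflexive far) (near_sym : symmetric near).

Lemma word_adj_sym n (a : 'I_n -> A) : symmetric (word_adj a).
Proof. by move=> i j; rewrite /word_adj far_sym near_sym [X in _ && X]orbC. Qed.

Lemma word_adj_irr n (a : 'I_n -> A) : irreflexive (word_adj a).
Proof. by move=> i; rewrite /word_adj far_irr; lia. Qed.

(** Containment amounts to the existence of a labelling that is a model, and each clause of
    [pg_model] has one of the definable forms above. *)
Lemma definable_contains_pg (F : pathograph) : pg_wf F ->
  definable (fun n (a : 'I_n -> A) => contains_pg (word_adj a) F).
Proof.
move=> wfF; apply: (@definable_ext _ (fun n a => exists l, @pg_model F _ (word_adj a) l)).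
  move=> n a; split; last exact: contains_pg_model.
  by apply: model_contains_pg => //; [exact: word_adj_sym|exact: word_adj_irr].
apply: definable_exists; rewrite /pg_model.
pose uA := fst : A * pg_label F -> A.
apply: definable_and; last apply: definable_and; last apply: definable_and;
  last apply: definable_and; last apply: definable_and; last apply: definable_and;
  last apply: definable_and.
- apply: definable_forall_fin => v; apply: definable_and.
    exact: (definable_some (on_vertex v \o snd)).
  exact: (definable_unique (on_vertex v \o snd)).
- apply: definable_forall_fin => u; apply: definable_and.
    exact: (definable_unique (fun b => on_urpath u b.2 && is_first b.2)).
  exact: (definable_unique (fun b => on_urpath u b.2 && is_last b.2)).
- apply: definable_forall_fin => u.
  exact: (definable_minimally_linked uA (on_urpath u \o snd)
    (@is_first F \o snd) (@is_last F \o snd)).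
- apply: definable_forall_fin => v; apply: definable_forall_fin => w.
  apply: definable_and; apply: definable_imply; try exact: definable_const.
    exact: (definable_adj uA (fun b c => on_vertex v b.2 && on_vertex w c.2)).
  exact: (definable_adj uA (fun b c => on_vertex v b.2 && on_vertex w c.2)).
- apply: definable_forall_fin => v; apply: definable_forall_fin => u; apply: definable_not.
  exact: (definable_adj uA (fun b c => [&& on_vertex v b.2, on_urpath u c.2 &
     ~~ [|| pg_S F v u, (v == pg_a F u) && is_first c.2 | (v == pg_b F u) && is_last c.2]])).
- apply: definable_forall_fin => u; apply: definable_and.
    exact: (definable_adj uA (fun b c =>
      [&& on_vertex (pg_a F u) b.2, on_urpath u c.2 & is_first c.2])).
  exact: (definable_adj uA (fun b c =>
    [&& on_vertex (pg_b F u) b.2, on_urpath u c.2 & is_last c.2])).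
- apply: definable_forall_fin => v; apply: definable_forall_fin => u.
  apply: definable_imply; first exact: definable_const.
  exact: (definable_adj uA (fun b c => on_vertex v b.2 && on_urpath u c.2)).
- apply: definable_forall_fin => u; apply: definable_forall_fin => u'.
  apply: definable_imply; first exact: definable_const.
  apply: definable_and; apply: definable_imply; try exact: definable_const.
    exact: (definable_adj uA (fun b c => on_urpath u b.2 && on_urpath u' c.2)).
  exact: (definable_adj uA (fun b c => on_urpath u b.2 && on_urpath u' c.2)).
Qed.
End WordGraph.

(** * Finite intersections and concatenations of regular languages *)

Lemma regular_definable (B : finType) (L : seq B -> Prop) :
  definable (fun n f => L (codom f)) -> regular L.
Proof.
case=> K rK hK; apply: regular_ext rK => w.
suff -> : w = codom (tnth (in_tuple w)) by exact: hK.
by rewrite /codom /image_mem map_tnth_enum.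
Qed.

Lemma regular_forall_fin (B I : finType) (L : I -> seq B -> Prop) :
  (forall i, regular (L i)) -> regular (fun w => forall i, L i w).
Proof.
move=> rL; apply/regular_definable/definable_forall_fin => i.
by exists (L i).
Qed.

Lemma regular_flatten (B : finType) (I : eqType) (L : I -> seq B -> Prop) (s : seq I) :
  uniq s -> (forall i, regular (L i)) ->
  regular (fun w => exists ws, (forall i, i \in s -> L i (ws i)) /\ w = flatten (map ws s)).
Proof.
move=> + rL; elim: s => [|i s IH] /=.
  (* The empty word is the only one without any letter. *)
  move=> _; apply: regular_ext (regular_not (regular_has predT)) => w.
  case: w => [|b w] /=; last by split=> // -[? []].
  by split=> // _; exists (fun=> [::]).
case/andP=> Nis us; apply: regular_ext (regular_cat (rL i) (IH us)) => w; split.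
  (* As the indices are distinct, changing the value at [i] leaves the other factors intact. *)
  case=> w1 [_ [-> L1 [ws [Lws ->]]]]; exists (fun j => if j == i then w1 else ws j); split.
    move=> j; rewrite inE; case: eqVneq => [->|Nji] //=; exact: Lws.
  rewrite eqxx; congr (_ ++ flatten _); apply/eq_in_map => j js.
  by case: eqVneq => // E; rewrite -E js in Nis.
case=> ws [Lws ->]; exists (ws i), (flatten (map ws s)); split=> //.
  by apply: Lws; rewrite inE eqxx.
by exists ws; split=> // j js; apply: Lws; rewrite inE js orbT.
Qed.

Lemma onth_some (B : Type) (b : B) s i : i < size s -> onth s i = Some (nth b s i).
Proof. by move=> li; rewrite onthE (nth_map b). Qed.

(** * Regularity of the set of determination strings *)

Section DeterminationStrings.
Variable H : pathograph.
Hypothesis H_wf : pg_wf H.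
Hypothesis H_norung : forall u u', ~~ pg_R H u u'.

Notation letter := ('I_(pg_nu H) * {set 'I_(pg_nv H)})%type.

(* [None] stands for an endpoint of the urpath. *)
Definition urpath_step u (x y : option letter) : bool :=
  [&& isSome x || isSome y,
      (if y is Some c then [&& c.1 == u, isSome x || (pg_a H u \in c.2) &
         [forall v in c.2, [|| pg_S H v u, v == pg_b H u | (v == pg_a H u) && ~~ isSome x]]]
       else true) &
      (if x is Some c then (isSome y || (pg_b H u \in c.2)) &&
         [forall v in c.2, [|| pg_S H v u, v == pg_a H u | (v == pg_b H u) && ~~ isSome y]]
       else true)].

(** Every gap is tested, including the two at the ends; the empty word fails because its only gap
    has [None] on both sides. That each spoke carries an edge is not local and is required
    separately. *)
Definition urpath_string u (s : seq letter) :=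
  (forall k, k <= size s -> urpath_step u (letter_before s k) (onth s k)) /\
  (forall v, pg_S H v u -> has (fun c : letter => v \in c.2) s).

Lemma regular_urpath_string u : regular (urpath_string u).
Proof.
apply: regular_and.
  apply: regular_ext (regular_not (regular_consecutive (fun x y => ~~ urpath_step u x y))) => w.
  split=> [N k lk|A [k /A ->]] //.
  by apply/negPn/negP => B; case: N; exists k.
apply: regular_forall_fin => v; case: (pg_S H v u); last first.
  by apply: regular_ext (regular_const _ true).
apply: regular_ext (regular_has (fun c : letter => v \in c.2)) => w.
by split=> // /(_ isT).
Qed.

(** Each letter is tested twice. The gap before it confines the left endpoint, unless that is a
    spoke, to the first letter; the gap after it confines the right endpoint to the last. As the
    endpoints differ, the two tests together settle every neighbour that is not a spoke. *)
Lemma urpath_stringP u (s : seq letter) : urpath_string u s <->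
  [/\ 0 < size s,
      (forall i, i < size s -> (nth (u, set0) s i).1 = u),
      (forall i v, i < size s -> ~~ pg_S H v u -> (v \in (nth (u, set0) s i).2) =
         ((v == pg_a H u) && (i == 0)) || ((v == pg_b H u) && (i.+1 == size s))),
      (pg_a H u \in (nth (u, set0) s 0).2) && (pg_b H u \in (nth (u, set0) s (size s).-1).2) &
      (forall v, pg_S H v u -> exists2 i, i < size s & v \in (nth (u, set0) s i).2)].
Proof.
set c := nth (u, set0) s.
have before k : k <= size s -> letter_before s k = if k is j.+1 then Some (c j) else None.
  by case: k => // k lk; exact: onth_some.
have at_ k : onth s k = if k < size s then Some (c k) else None.
  by case: ltnP => lk; [exact: onth_some|exact: onth_default].
have Nab : pg_a H u != pg_b H u by case: H_wf => _ _ _ _ /(_ u) /andP[].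
split=> [[St Sp]|[s0 cu cN /andP[ca cb] cS]].
  have s0 : 0 < size s.
    by have := St 0 isT; rewrite before // at_; case: (0 < size s).
  have St1 i : i < size s -> urpath_step u (if i is j.+1 then Some (c j) else None) (Some (c i)).
    by move=> li; have := St i (ltnW li); rewrite before ?at_ ?li // ltnW.
  have St2 i : i < size s -> urpath_step u (Some (c i))
      (if i.+1 < size s then Some (c i.+1) else None).
    by move=> li; have := St i.+1 li; rewrite before ?at_.
  have ca : pg_a H u \in (c 0).2 by case/and3P: (St1 0 s0) => _ /and3P[].
  have cb : pg_b H u \in (c (size s).-1).2.
    by have := St2 (size s).-1; rewrite prednK // ltnn => /(_ (leqnn _)) /and3P[_ _ /andP[]].
  split=> //; last 2 first.
  - by rewrite ca cb.
  - by move=> v /Sp /(has_nthP (u, set0)).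
  - by move=> i /St1 /and3P[_ /and3P[/eqP]].
  move=> i v li NS; apply/idP/idP => [vi|]; last first.
    case/orP=> /andP[/eqP -> /eqP Ei]; first by rewrite Ei.
    by rewrite -Ei in cb.
  have /and3P[_ /and3P[_ _ /forall_inP /(_ v vi) P1] _] := St1 i li.
  have /and3P[_ _ /andP[_ /forall_inP /(_ v vi) P2]] := St2 i li.
  move: P2 P1; rewrite (negbTE NS) /=.
  have [->|Na] := eqVneq v (pg_a H u).
    by rewrite (negbTE Nab) /=; case: (i).
  rewrite /= => /andP[-> Ni] _ /=; move: Ni; case: ltnP => //; lia.
split.
  move=> k lk; rewrite before // at_; apply/and3P; split.
  - by case: k lk => // _; rewrite s0.
  - case: ltnP => // lk'; rewrite cu // eqxx /=; apply/andP; split.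
      by case: k lk lk' => //=.
    apply/forall_inP => v vk; have [//|NS] := boolP (pg_S H v u).
    move: vk; rewrite /c cN //; case/orP=> /andP[-> //]; by case: (k); rewrite ?orbT.
  - case: k lk => // k lk; apply/andP; split.
      case: ltnP => //= lk'; by have -> : k = (size s).-1 by lia.
    apply/forall_inP => v vk; have [//|NS] := boolP (pg_S H v u).
    move: vk; rewrite /c cN //; case/orP=> /andP[-> //] /eqP ->; by rewrite ltnn orbT.
by move=> v /cS [i li vi]; apply/(has_nthP (u, set0)); exists i.
Qed.

Definition realization_string (w : seq letter) :=
  exists (m : 'I_(pg_nu H) -> nat) (X : rel (rvert H m)),
    is_realization X /\ det_string X = w.

(** Without rungs the urpaths do not constrain each other, so a realization amounts to an
    independent choice of a string for each urpath. *)
Lemma realization_stringP w : realization_string w <->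
  exists ws, (forall u, u \in enum 'I_(pg_nu H) -> urpath_string u (ws u)) /\
             w = flatten (map ws (enum 'I_(pg_nu H))).
Proof.
split=> [[m [X [rX <-]]]|[ws [Lws ->]]].
  exists (fun u => [seq (u, [set v | radj X (ivert i) (inl v)]) | i <- enum 'I_(m u)]).
  split=> // u _; have [m0 XA XS _] := rX; apply/urpath_stringP.
  set s := map _ _; have sz : size s = m u by rewrite size_map size_enum_ord.
  have nths (i : 'I_(m u)) : nth (u, set0) s i = (u, [set v | radj X (ivert i) (inl v)]).
    by rewrite (nth_map i) ?size_enum_ord // nth_ord_enum.
  rewrite sz; have lm : (m u).-1 < m u by rewrite prednK.
  split=> //.
  - by move=> i li; rewrite (nths (Ordinal li)).
  - move=> i v li NS; rewrite (nths (Ordinal li)) inE radj_sym radj_spoke //.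
    have /negbTE -> : ~~ X (inl v) (ivert (Ordinal li)) by apply: contra NS => /XA.
    by rewrite orbF.
  - rewrite (nths (Ordinal (m0 u))) (nths (Ordinal lm)) !inE !(radj_sym _ (ivert _)) !radj_spoke //.
    by rewrite /= prednK // !eqxx orbT.
  - move=> v /XS [i Xi]; exists i => //.
    by rewrite nths inE radj_sym radj_spoke // Xi !orbT.
pose m u := size (ws u).
pose c u i := nth (u, set0) (ws u) i.
(* The extra edges are read off from the letters at the spokes; all other neighbours in the letters
   come from structural edges. *)
pose X : rel (rvert H m) := fun x y => match x, y with
  | inl v, inr p => pg_S H v (tag p) && (v \in (c (tag p) (tagged p)).2)
  | _, _ => false end.
have L u := (urpath_stringP u (ws u)).1 (Lws u (mem_enum _ u)).
have rX : is_realization X.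
  split.
  - by move=> u; case: (L u).
  - by move=> [v|p] [w'|q] //= /andP[].
  - move=> v u Svu; have [_ _ _ _ /(_ v Svu) [i li vi]] := L u.
    by exists (Ordinal (li : i < m u)); rewrite /= Svu.
  - by move=> u u' Ru; have := H_norung u u'; rewrite Ru.
exists m, X; split=> //; rewrite /det_string; congr flatten; apply: eq_map => u.
have [m0 cu cN /andP[ca cb] _] := L u.
apply: (@eq_from_nth _ (u, set0)); first by rewrite size_map size_enum_ord.
move=> i; rewrite size_map size_enum_ord => li; pose i' := Ordinal li.
rewrite (nth_map i') ?size_enum_ord // (nth_ord_enum i' i').
rewrite [RHS]surjective_pairing cu //; congr pair.
apply/setP => v; rewrite inE radj_sym radj_spoke //= /c.
have [Sv|NS] := boolP (pg_S H v u); last by rewrite cN // orbF.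
apply/idP/idP => [|->]; last by rewrite !orbT.
case/or3P=> [/andP[/eqP -> /eqP ->]|/andP[/eqP -> /eqP Ei]|] //.
by rewrite -[i]/(i.+1.-1) Ei.
Qed.

Lemma regular_realization_string : regular realization_string.
Proof.
apply: regular_ext (regular_flatten (enum_uniq _) regular_urpath_string) => w.
by split=> /realization_stringP.
Qed.

(** * The realization as the graph of a word *)

Notation gletter := ('I_(pg_nv H) + letter)%type.

(** A letter lists the neighbours in [H] of its internal vertex, so these edges do not depend on
    positions. *)
Definition far_adj : rel gletter := fun x y => match x, y with
  | inl v, inl w => pg_E H v w
  | inl v, inr c | inr c, inl v => v \in c.2
  | inr _, inr _ => false
  end.

(** Comparing the urpaths separates the last letter of one urpath from the first letter of the
    next. *)
Definition near_adj : rel gletter := fun x y =>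
  match x, y with inr c, inr d => c.1 == d.1 | _, _ => false end.

Lemma far_adj_sym : symmetric far_adj.
Proof. by case: H_wf => E_sym _ _ _ _ [v|c] [w|d] //=. Qed.

Lemma far_adj_irr : irreflexive far_adj.
Proof. by case: H_wf => _ E_irr _ _ _ [v|c] //=. Qed.

Lemma near_adj_sym : symmetric near_adj.
Proof. by case=> [v|c] [w|d] //=; rewrite eq_sym. Qed.

Definition graph_word (w : seq letter) : seq gletter :=
  map inl (enum 'I_(pg_nv H)) ++ map inr w.

(** The internal vertices of an urpath fill a block of consecutive positions in path order,
    beginning at [off]. *)
Lemma index_internal (m : 'I_(pg_nu H) -> nat) (us : seq 'I_(pg_nu H)) : uniq us ->
  exists off, forall p : {u & 'I_(m u)}, tag p \in us ->
    index p [seq Tagged (fun u => 'I_(m u)) i | u <- us, i <- enum 'I_(m u)] =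
    off (tag p) + tagged p.
Proof.
elim: us => [|u us IH] /=; first by exists (fun=> 0).
case/andP=> Nu /IH [off hoff].
exists (fun u' => if u' == u then 0 else m u + off u') => -[u' i] /=.
rewrite inE index_cat; have [Eu|Nuu'] := eqVneq u' u => /= [_|us'].
  subst u'; have tI : injective (Tagged (fun u => 'I_(m u)) : 'I_(m u) -> _).
    by move=> j k /eqP; rewrite eq_Tagged /= => /eqP.
  by rewrite ifT ?(index_map tI) ?index_enum_ord // (mem_map tI) mem_enum.
rewrite ifF; last first.
  by apply/negP => /mapP[j _ [E _]]; rewrite E eqxx in Nuu'.
by rewrite size_map size_enum_ord hoff //= addnA.
Qed.

(** Listing the vertices of [H] and then the internal vertices urpath by urpath gives a bijection
    from positions to vertices that carries word adjacency to adjacency in the realization. *)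
Lemma graph_word_iso (m : 'I_(pg_nu H) -> nat) (X : rel (rvert H m)) : is_realization X ->
  exists n (f : 'I_n -> gletter), codom f = graph_word (det_string X) /\
    forall F, contains_pg (word_adj far_adj near_adj f) F <-> contains_pg (radj X) F.
Proof.
move=> rX; have [m0 XA _ _] := rX.
pose verts := [seq Tagged (fun u => 'I_(m u)) i | u <- enum 'I_(pg_nu H), i <- enum 'I_(m u)].
pose VS : seq (rvert H m) := map inl (enum 'I_(pg_nv H)) ++ map inr verts.
pose code (x : rvert H m) : gletter := match x with
  | inl v => inl v
  | inr p => inr (tag p, [set v | radj X (inr p) (inl v)]) end.
have verts_all p : p \in verts.
  by case: p => u i; apply/allpairsPdep; exists u, i; rewrite !mem_enum.
have verts_uniq : uniq verts.
  apply: allpairs_uniq_dep => [|u _|]; try exact: enum_uniq.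
  by move=> [u i] [u' j] _ _ /=.
have inlI : injective (@inl 'I_(pg_nv H) {u & 'I_(m u)}) by move=> ? ? [].
have inrI : injective (@inr 'I_(pg_nv H) {u & 'I_(m u)}) by move=> ? ? [].
have VS_all x : x \in VS.
  rewrite mem_cat; case: x => [v|p]; rewrite ?(mem_map inlI) ?(mem_map inrI).
    by rewrite mem_enum.
  by rewrite verts_all orbT.
have VS_uniq : uniq VS.
  rewrite cat_uniq (map_inj_uniq inlI) (map_inj_uniq inrI) enum_uniq verts_uniq andbT /=.
  by apply/hasPn => _ /mapP[p _ ->]; apply/negP => /mapP[].
pose h := tnth (in_tuple VS).
have hI : injective h by apply/tuple_uniqP.
have h_index i : index (h i) VS = i.
  by rewrite /h (tnth_nth (h i)) index_uniq.
have /fin_all_exists [g hg] : forall x, exists i, h i = x.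
  by move=> x; have /(tnthP (in_tuple VS)) [i ->] := VS_all x; exists i.
have [off hoff] := @index_internal m _ (enum_uniq 'I_(pg_nu H)).
have idx p : index (inr p) VS = size (enum 'I_(pg_nv H)) + (off (tag p) + tagged p).
  rewrite index_cat ifF; last by apply/negP => /mapP[].
  by rewrite size_map (index_map inrI) hoff ?mem_enum.
have X_vv v w : X (inl v) (inl w) = false by apply/negP => /XA.
have X_uu p q : X (inr p) (inr q) = false.
  by apply/negP => /XA /=; exact/negP/H_norung.
have E_sym : symmetric (pg_E H) by case: H_wf.
have h_adj i j : radj X (h i) (h j) = word_adj far_adj near_adj (code \o h) i j.
  rewrite /word_adj /=; case: (h i) (h_index i) => [v|[u k]] Ei.
    case: (h j) => [w|p] /=; last by rewrite inE radj_sym orbF.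
    by rewrite /radj /= !X_vv E_sym !orbF orbb.
  case: (h j) (h_index j) => [w|[u' l]] Ej /=; first by rewrite inE orbF.
  rewrite /radj /= !X_uu !orbF; rewrite !idx /= in Ei Ej; rewrite -Ei -Ej (eq_sym u').
  have [Eu|//] := eqVneq u u'; rewrite -{}Eu /= in l Ej *.
  (* Both positions lie in the block of the same urpath, so the offsets cancel. *)
  by rewrite -!addnS !eqn_add2l.
exists (size VS), (code \o h); split.
  rewrite /codom /image_mem (map_comp code h) map_tnth_enum map_cat.
  rewrite -(map_comp code inl) -(map_comp code inr) /graph_word; congr (_ ++ _).
  rewrite /det_string /verts !map_flatten -!map_comp.
  congr flatten; apply: eq_map => u; rewrite /= -(map_comp inr) -(map_comp (code \o inr)).
  exact: eq_map.
move=> F; split.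
  by apply: (@contains_pg_embed _ _ _ _ h) => // i j; rewrite h_adj.
apply: (@contains_pg_embed _ _ _ _ g) => [|x y]; first exact: can_inj hg.
by rewrite -h_adj !hg.
Qed.

End DeterminationStrings.

(** * The automaton for determination strings of free realizations *)

Theorem theorem7 (H : pathograph) (Fs : seq pathograph) :
  pg_wf H ->
  (forall u u', ~~ pg_R H u u') ->
  (forall F, List.In F Fs -> pg_wf F) ->
  exists M : dfa ('I_(pg_nu H) * {set 'I_(pg_nv H)})%type,
    forall w : seq ('I_(pg_nu H) * {set 'I_(pg_nv H)}),
      dfa_accepts M w <->
      exists (m : 'I_(pg_nu H) -> nat) (X : rel (rvert H m)),
        [/\ is_realization X, pg_free (radj X) Fs & det_string X = w].
Proof.
move=> H_wf H_norung Fs_wf.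
(* Freeness is a finite conjunction of negated containments, built by induction on the list. *)
have [L rL hL] : definable (fun n (f : 'I_n -> _) =>
    pg_free (word_adj (@far_adj H) (@near_adj H) f) Fs).
  elim: Fs Fs_wf => [|F Fs IH] wf.
    by apply: definable_ext (definable_const _ true) => n f; split=> // _ F [].
  apply: definable_ext (definable_and (definable_not (definable_contains_pg
    (far_adj_sym H_wf) (far_adj_irr H_wf) (@near_adj_sym H) (wf F (or_introl erefl))))
    (IH (fun F' FF' => wf F' (or_intror FF')))).
  move=> n f; split=> [[N A] F' [<- //|/A //]|N].
  by split=> [|F' FF']; apply: N; [left|right].
have [M hM] : regular (fun w => realization_string w /\ L (graph_word w)).
  apply: regular_and; first exact: regular_realization_string.
  exact: regular_map (regular_prefix _ rL).
exists M => w; rewrite hM.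
(* Freeness depends on the determination string alone, so any realization with that string may serve
   as witness. *)
have free m (X : rel (rvert H m)) : is_realization X ->
    L (graph_word (det_string X)) <-> pg_free (radj X) Fs.
  move=> rX; have [n [f [<- E]]] := graph_word_iso H_wf H_norung rX.
  rewrite hL; by split=> A F /A N /E.
split=> [[[m [X [rX <-]]] /(free _ _ rX)]|[m [X [rX fX <-]]]]; first by exists m, X.
by split; [exists m, X|apply/free].
Qed.
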